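(* Let $n\ge 1$ and let $a\le b$ be integers with $a+b=0$ or $a+b=1$. Then the number of regions of the arrangement $\mathcal{A}[K_n^{ab}]$ is equal to the number of $(1-a,b)$-rooted labelled forests with $n$ vertices.
   Context: Write $[n]=\{1,\dots,n\}$ and, for integers $a\le b$, $[a,b]=\{k\in\mathbb{Z}: a\le k\le b\}$; intervals $[1,m]$ with $m=0$ are empty. $\mathcal{A}[K_n^{ab}]$ is the affine hyperplane arrangement in $\mathbb{R}^n$ consisting of all hyperplanes $x_j-x_i=g$ with $1\le i<j\le n$ and $g\in[a,b]$. Its regions are the connected components of the complement in $\mathbb{R}^n$ of the union of the hyperplanes. For natural numbers $\alpha,\beta\ge 0$, an $(\alpha,\beta)$-rooted labelled tree on a finite set $V$ of positive integers is a rooted tree with vertex set $V$, each of whose edges $(i,j)$, with $i$ the parent and $j$ the child, is weighted with an integer from $[1,\alpha]$ if $i<j$, and from $[1,\beta]$ if $i>j$. An $(\alpha,\beta)$-rooted labelled forest with $n$ vertices is a disjoint union (unordered) of $(\alpha,\beta)$-rooted labelled trees whose vertex sets partition $[n]$. *)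

(* Defs.v *)
(* MathComp / MathComp-Analysis. *)
From HB Require Import structures.
From mathcomp Require Import all_boot all_order all_algebra.
From mathcomp Require Import all_classical all_reals all_analysis.

Set Implicit Arguments.
Unset Strict Implicit.
Unset Printing Implicit Defensive.

Import Order.TTheory GRing.Theory Num.Theory.
Import numFieldNormedType.Exports.

(* The label set {1, ..., n} is represented by 'I_n = {0, ..., n-1}; only the
   order of the labels matters below. *)

Section Forests.
Variables (alpha beta n : nat).

(* A triple (V, r, w): vertex set, root, weighted edges.  w (i, j) = Some k
   means that there is an edge with parent i, child j and weight k (the number
   k itself), and w (i, j) = None that there is none.  The bound on k only
   serves to make the type finite: see weights_ok. *)
Definition wtree : finType :=
  ({set 'I_n} * 'I_n * {ffun 'I_n * 'I_n -> option 'I_(maxn alpha beta).+1})%type.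

Definition verts (t : wtree) : {set 'I_n} := t.1.1.
Definition troot (t : wtree) : 'I_n := t.1.2.
Definition weight (t : wtree) (i j : 'I_n) : option 'I_(maxn alpha beta).+1 :=
  t.2 (i, j).
Definition parent (t : wtree) : rel 'I_n := fun i j => isSome (weight t i j).

(* The root has no parent, every other vertex has exactly one, and every vertex
   is a descendant of the root. *)
Definition is_rooted_tree (t : wtree) : bool :=
  [&& troot t \in verts t,
      [forall i, forall j,
         parent t i j ==> (i \in verts t) && (j \in verts t)],
      [forall j in verts t,
         #|[pred i | parent t i j]| == (if j == troot t then 0 else 1)] &
      [forall j in verts t, connect (parent t) (troot t) j]].

Definition weights_ok (t : wtree) : bool :=
  [forall i, forall j,
     if weight t i j is Some k
     then 1 <= k <= (if i < j then alpha else beta)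
     else true].

(* An unordered forest is a set of trees; injectivity of verts says that
   distinct trees have distinct, hence (by partition) disjoint, vertex sets. *)
Definition is_forest (F : {set wtree}) : bool :=
  [&& [forall t in F, is_rooted_tree t && weights_ok t],
      dinjectiveb verts (mem F) &
      finset.partition (verts @: F) [set: 'I_n]%SET].

Definition num_forests : nat := #|[pred F | is_forest F]|.

End Forests.

Local Open Scope classical_set_scope.
Local Open Scope ring_scope.

Definition hyperplane (R : realType) (n : nat) (i j : 'I_n) (g : int) :
    set 'rV[R]_n :=
  [set x | x ord0 j - x ord0 i = g%:~R].

Arguments hyperplane R {n} i j g.

Definition arrangement (R : realType) (n : nat) (a b : int) :
    set (set 'rV[R]_n) :=
  [set H | exists (i j : 'I_n) (g : int),
     [/\ (i < j)%N, a <= g <= b & H = hyperplane R i j g]].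

Arguments arrangement R n a b : clear implicits.

Definition regions (T : topologicalType) (A : set (set T)) : set (set T) :=
  let M := ~` \bigcup_(H in A) H in
  [set C | exists2 x, M x & C = connected_component M x].

(* Main.v *)
(* Mark on the line, for every vertex u and 0 <= g <= b, the letter (u, g) at the
   position x_u + g.  A region records which letters (u, g) precede (v, 0) for
   g < b, and also for g = b when u and v are in the relation D (all pairs if
   a + b = 0, the pairs u < v if a + b = 1).  Sending v to the letter immediately
   before (v, 0) gives an injective acyclic parent map on the slots (u, g), that
   is, a labelled (b+1)-ary tree.  The order of the letters can be recovered from
   the tree, and every tree occurs.  A pair (u, b), (v, 0) of neighbouring letters
   outside D may be exchanged without leaving the region; exchanging such pairs as
   long as (u, b) comes first shows that the regions correspond to the trees in
   which D u v holds whenever v is the child of u in slot b.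

   These trees correspond to forests: processing the vertices one by one, the
   "at most one child per slot" condition is traded for arbitrarily many children
   in the slots g < b, with weight g + 1, and in slot b, if a + b = 0, for
   arbitrarily many children with a larger label, with weight b + 1. *)

Require Import Defs.
From mathcomp Require Import all_boot all_order all_algebra.
From mathcomp Require Import all_classical all_reals all_analysis.
From mathcomp Require Import perm zify lra.

Import Order.TTheory GRing.Theory Num.Theory.
Import numFieldNormedType.Exports.

Set Implicit Arguments.
Unset Strict Implicit.
Unset Printing Implicit Defensive.

(** * Orders on the letters *)

Section LetterOrders.
Local Open Scope ring_scope.
Variables (R : realFieldType) (n b : nat) (D : rel 'I_n).

Local Notation letter := ('I_n * 'I_b.+1)%type.

(** The order arguments use only these properties of the positions [x_u + g]. The exchange of a
    neighbouring pair [(u, b)], [(v, 0)] with [u != v] preserves them, although it may destroy the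
    form [x_u + g]. *)
Definition valid (pos : letter -> R) : Prop :=
  [/\ injective pos,
      forall u (g h : 'I_b.+1), (g < h)%N -> pos (u, g) < pos (u, h) &
      forall u v (g h g' h' : 'I_b.+1), (g + h' = g' + h)%N ->
        (pos (u, g) < pos (v, h)) = (pos (u, g') < pos (v, h'))].

Definition is_pred (pos : letter -> R) (v : 'I_n) (o : option letter) : Prop :=
  if o is Some l then
    pos l < pos (v, ord0) /\ forall l', pos l' < pos (v, ord0) -> pos l' <= pos l
  else forall l', ~~ (pos l' < pos (v, ord0)).

Definition compared (u v : 'I_n) (g : 'I_b.+1) : bool :=
  (g < b)%N || D u v.

Definition agree (pos pos' : letter -> R) : Prop :=
  forall u v g, u != v -> compared u v g ->
    (pos (u, g) < pos (v, ord0)) = (pos' (u, g) < pos' (v, ord0)).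

Definition last_slot_ok (p : 'I_n -> option letter) : Prop :=
  forall v u, p v = Some (u, ord_max) -> D u v.

Definition rank (pos : letter -> R) (v : 'I_n) : nat :=
  #|[pred l | pos l < pos (v, ord0)]|.

Lemma rank_lt pos u v : pos (u, ord0) < pos (v, ord0) ->
  (rank pos u < rank pos v)%N.
Proof.
move=> uv; apply: proper_card; apply/properP; split.
  by apply/fintype.subsetP => l; rewrite !inE => /lt_trans; apply.
by exists (u, ord0); rewrite !inE ?ltxx.
Qed.

Lemma pos_ge0 pos u g : valid pos -> pos (u, ord0) <= pos (u, g).
Proof.
case=> _ incr _; case: (eqVneq g ord0) => [->//|g0]; apply/ltW/incr.
by rewrite lt0n -(inj_eq val_inj) in g0 *.
Qed.

Lemma pos_same pos u g h : valid pos -> (pos (u, g) < pos (u, h)) = (g < h)%N.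
Proof.
case=> inj incr _; case: (ltngtP g h) => [/(incr u) -> //|/(incr u)/ltW|/val_inj ->].
  by rewrite leNgt => /negbTE.
by rewrite ltxx.
Qed.

Lemma parent_rank pos v u g : valid pos -> is_pred pos v (Some (u, g)) ->
  (rank pos u < rank pos v)%N.
Proof.
by move=> val [lt _]; apply/rank_lt/(le_lt_trans _ lt)/pos_ge0.
Qed.

Lemma exists_pred pos : valid pos ->
  exists p : 'I_n -> option letter, forall v, is_pred pos v (p v).
Proof.
move=> [inj _ _].
have H v : exists o, is_pred pos v o.
  case: (pickP [pred l | pos l < pos (v, ord0)]) => [l0 l0P|none].
    case: (@arg_maxP _ _ _ l0 [pred l | pos l < pos (v, ord0)] pos l0P) => l lP lmax.
    by exists (Some l).
  by exists None => l; rewrite [_ < _]none.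
by exists (fun v => projT1 (cid (H v))) => v; case: cid.
Qed.

Lemma pred_inj pos p : valid pos -> (forall v, is_pred pos v (p v)) ->
  injective p.
Proof.
move=> [inj incr _] pP.
have main v w : p v = p w -> ~~ (pos (v, ord0) < pos (w, ord0)).
  move=> epq; apply/negP => vw; have := pP v; have := pP w; rewrite epq.
  case: (p w) => [l [_ /(_ _ vw) le] [lt _]|].
    by move: (le_lt_trans le lt); rewrite ltxx.
  by move=> /(_ (v, ord0)); rewrite vw.
move=> v w e; have := main _ _ e; have := main _ _ (esym e).
rewrite -!leNgt => h1 h2.
by have /inj[] : pos (v, ord0) = pos (w, ord0) by apply/eqP; rewrite eq_le h1 h2.
Qed.

(** Subtracting the smaller shift from both letters brings one of them to shift 0. If this is the
    letter of [u], the known comparison is the opposite one, and injectivity makes its negation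
    strict. *)
Lemma lt_letters pos pos' u v : valid pos -> valid pos' -> 
  (forall g, (pos (u, g) < pos (v, ord0)) = (pos' (u, g) < pos' (v, ord0))) ->
  (forall g, (pos (v, g) < pos (u, ord0)) = (pos' (v, g) < pos' (u, ord0))) ->
  forall g h, (pos (u, g) < pos (v, h)) = (pos' (u, g) < pos' (v, h)).
Proof.
move=> V V' uv vu g h.
case: (eqVneq u v) => [<-|neq]; first by rewrite !pos_same.
have [inj incr shift] := V; have [inj' incr' shift'] := V'.
case: (leqP h g) => hg.
  have lt : (g - h < b.+1)%N by rewrite (leq_ltn_trans (leq_subr _ _)).
  rewrite (shift _ _ g h (Ordinal lt) ord0) /= ?addn0 ?subnK //.
  by rewrite (shift' _ _ g h (Ordinal lt) ord0) /= ?addn0 ?subnK.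
have lt : (h - g < b.+1)%N by rewrite (leq_ltn_trans (leq_subr _ _)).
have := shift v u h g (Ordinal lt) ord0.
have := shift' v u h g (Ordinal lt) ord0.
rewrite /= addn0 subnK 1?ltnW // => /(_ erefl) e' /(_ erefl) e.
rewrite lt_neqAle leNgt e [pos' _ < _]lt_neqAle leNgt e' vu.
rewrite (inj_eq inj) (inj_eq inj') //.
Qed.

(** A letter other than the predecessor [(w, k)] of [(v, 0)] lies before [(v, 0)] iff it lies before
    [(w, k)]. As [w] has smaller rank than [v], induction on the sum of the two ranks applies. *)
Lemma eq_pred_eq_order pos pos' p : valid pos -> valid pos' ->
  (forall v, is_pred pos v (p v)) -> (forall v, is_pred pos' v (p v)) ->
  forall l l', (pos l < pos l') = (pos' l < pos' l').
Proof.
move=> V V' P P'.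
suff H : forall N u v g, (rank pos u + rank pos v < N)%N ->
    (pos (u, g) < pos (v, ord0)) = (pos' (u, g) < pos' (v, ord0)).
  move=> [u g] [v h]; apply: lt_letters => // k; [exact: H (ltnSn _)|].
  exact: H (ltnSn _).
elim=> // N IH u v g; rewrite ltnS => leN.
have := P v; have := P' v; have := @parent_rank pos v.
case: (p v) => [[w k]|_ none' none]; last first.
  by rewrite (negbTE (none _)) (negbTE (none' _)).
move=> /(_ w k V) wv [lt' max'] [lt max].
have {}wv : (rank pos u + rank pos w < N)%N.
  by apply: leq_trans leN; rewrite ltn_add2l wv.
have wv' : (rank pos w + rank pos u < N)%N by rewrite addnC.
have same g1 g2 := @lt_letters pos pos' u w V V' (fun g => IH u w g wv)
  (fun g => IH w u g wv') g1 g2.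
case: (eqVneq (u, g) (w, k)) => [->|neq]; first by rewrite lt lt'.
have [inj _ _] := V; have [inj' _ _] := V'.
apply/idP/idP => [/max|/max'].
  by rewrite le_eqVlt (inj_eq inj) (negbTE neq) same => /lt_trans; apply.
by rewrite le_eqVlt (inj_eq inj') (negbTE neq) -same => /lt_trans; apply.
Qed.

(** A positive [h] brings the difference of the shifts below [b], where all pairs are compared. *)
Lemma agree_compared pos pos' u v (g h : 'I_b.+1) :
  valid pos -> valid pos' -> agree pos pos' -> u != v ->
  (h <= g)%N -> (0 < h)%N || compared u v g ->
  (pos (u, g) < pos (v, h)) = (pos' (u, g) < pos' (v, h)).
Proof.
move=> [_ _ shift] [_ _ shift'] ag uv hg cmp.
have lt : (g - h < b.+1)%N by rewrite (leq_ltn_trans (leq_subr _ _)).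
have E : (g + ord0 (n' := b) = Ordinal lt + h)%N by rewrite addn0 subnK.
rewrite (shift _ _ _ _ _ _ E) (shift' _ _ _ _ _ _ E) ag //.
have := ltn_ord g; rewrite ltnS => gb.
rewrite /compared /=; case: posnP cmp => [->|h0 _]; first by rewrite subn0.
by rewrite (leq_trans _ gb) // ltn_subLR // -addn1 addnC leq_add2r.
Qed.

(** Outside [D] the comparison of [(u, b)] with [(v, 0)] is inherited from the predecessor [(w, k)]
    of [(v, 0)]. By [last_slot_ok] the pair [(w, k)], [(v, 0)] is compared; that [(u, b)] precedes
    [(w, k)] transfers by [agree_compared] if [k > 0] and by induction if [k = 0]. *)
Lemma agree_far pos pos' p p' : valid pos -> valid pos' ->
  (forall v, is_pred pos v (p v)) -> (forall v, is_pred pos' v (p' v)) ->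
  last_slot_ok p -> last_slot_ok p' -> agree pos pos' ->
  forall u v, u != v -> pos (u, ord_max) < pos (v, ord0) ->
    pos' (u, ord_max) < pos' (v, ord0).
Proof.
move=> V V' P P' ok ok' ag u.
suff H : forall N v, (rank pos v < N)%N -> u != v ->
   pos (u, ord_max) < pos (v, ord0) -> pos' (u, ord_max) < pos' (v, ord0).
  by move=> v; exact: H (ltnSn _).
elim=> // N IH v; rewrite ltnS => leN uv far.
case Duv: (D u v); first by rewrite -ag // /compared Duv orbT.
have := P v; have := @parent_rank pos v; have := ok v.
case: (p v) => [[w k]|_ _ /(_ (u, ord_max))]; last by rewrite far.
move=> okv /(_ w k V) wv [lt max]; have {}wv := wv (conj lt max).
have wneq : w != v by apply: contraTneq wv => ->; rewrite ltnn.
have cmp : compared w v k.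
  have := ltn_ord k; rewrite ltnS leq_eqVlt /compared => /orP[/eqP kb|->//].
  by apply/orP; right; apply: okv; congr (Some (_, _)); apply: val_inj.
have lt' : pos' (w, k) < pos' (v, ord0) by rewrite -(ag w v k wneq cmp).
apply: lt_trans lt'; move: (max _ far); rewrite le_eqVlt.
have [inj incr _] := V; rewrite (inj_eq inj) => /orP[/eqP[e1 e2]|ukw].
  by move: Duv; rewrite okv // -e1 -e2.
case: (eqVneq u w) => [e|uw].
  by move: ukw; rewrite -e pos_same //= ltnNge -ltnS ltn_ord.
case: (posnP k) => [k0|k0].
  have e : k = ord0 by apply: val_inj.
  by rewrite e in ukw *; apply: IH => //; exact: leq_trans wv leN.
by rewrite -(@agree_compared pos) // ?k0 // -ltnS.
Qed.

Lemma agree_eq_order pos pos' p p' : valid pos -> valid pos' ->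
  (forall v, is_pred pos v (p v)) -> (forall v, is_pred pos' v (p' v)) ->
  last_slot_ok p -> last_slot_ok p' -> agree pos pos' ->
  forall l l', (pos l < pos l') = (pos' l < pos' l').
Proof.
move=> V V' P P' ok ok' ag.
have ag' : agree pos' pos by move=> u v g uv cmp; rewrite ag.
have H u v g : (pos (u, g) < pos (v, ord0)) = (pos' (u, g) < pos' (v, ord0)).
  case: (eqVneq u v) => [<-|uv]; first by rewrite !pos_same.
  case: (ltnP g b) => gb; first by apply: ag => //; rewrite /compared gb.
  have -> : g = ord_max by apply: val_inj; apply/eqP; rewrite eqn_leq gb -ltnS ltn_ord.
  apply/idP/idP; first exact: (agree_far V V' P P').
  exact: (agree_far V' V P' P).
by move=> [u g] [v h]; apply: lt_letters.
Qed.

Lemma eq_order_is_pred pos pos' v o :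
  (forall l l', (pos l < pos l') = (pos' l < pos' l')) ->
  is_pred pos v o -> is_pred pos' v o.
Proof.
move=> E; case: o => [l [lt max]|none l] /=; last by rewrite -E.
by split=> [|l']; rewrite -E // leNgt -E -leNgt; exact: max.
Qed.

Lemma is_pred_unique pos v o o' : valid pos ->
  is_pred pos v o -> is_pred pos v o' -> o = o'.
Proof.
move=> [inj _ _]; case: o o' => [l|] [l'|] //=.
- move=> [lt max] [lt' max']; congr Some; apply: inj.
  by apply/eqP; rewrite eq_le max ?max'.
- by move=> [lt _] /(_ l); rewrite lt.
- by move=> + [lt _] => /(_ l'); rewrite lt.
Qed.

(** * Exchanging a neighbouring pair of letters *)

Section Swap.
Variables (pos : letter -> R) (u v : 'I_n).
Hypotheses (V : valid pos) (uv : u != v).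
Hypothesis pred_v : is_pred pos v (Some (u, ord_max)).

Let swapped := pos \o tperm (u, ord_max) (v, ord0).

(** No letter lies between neighbours, so only the comparison of these two with each other
    changes. *)
Lemma swap_lt l l' :
  (swapped l < swapped l') =
  if (l == (u, ord_max)) && (l' == (v, ord0)) then false
  else if (l == (v, ord0)) && (l' == (u, ord_max)) then true
  else pos l < pos l'.
Proof.
have [inj _ _] := V; case: pred_v => lt max.
rewrite /swapped /=.
have ne : (u, @ord_max b) != (v, ord0) by rewrite xpair_eqE (negbTE uv).
have ne' : (v, ord0) != (u, @ord_max b) by rewrite eq_sym.
have up l1 : l1 != (u, ord_max) -> l1 != (v, ord0) ->
    (pos (u, ord_max) < pos l1) = (pos (v, ord0) < pos l1).
  move=> h1 h2; apply/idP/idP => [h|]; last exact: lt_trans.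
  rewrite lt_neqAle (inj_eq inj) eq_sym h2 leNgt; apply/negP => /max.
  by rewrite leNgt h.
have dn l1 : l1 != (u, ord_max) -> l1 != (v, ord0) ->
    (pos l1 < pos (u, ord_max)) = (pos l1 < pos (v, ord0)).
  move=> h1 h2; apply/idP/idP => [/lt_trans|]; first exact.
  by move=> /max; rewrite le_eqVlt (inj_eq inj) (negbTE h1).
case: tpermP => [->|->|/eqP l1 /eqP l2]; case: tpermP => [->|->|/eqP l1' /eqP l2'];
  rewrite ?eqxx ?(negbTE ne) ?(negbTE ne') ?(negbTE l1) ?(negbTE l2)
    ?(negbTE l1') ?(negbTE l2') ?andbF ?andbT /= ?ltxx //.
- by apply/negbTE; rewrite -leNgt ltW.
- by rewrite up.
- by rewrite up.
- by rewrite dn.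
- by rewrite dn.
Qed.

Lemma swap_valid : valid swapped.
Proof.
have [inj incr shift] := V; split.
- exact: inj_comp inj perm_inj.
- move=> w g h gh; rewrite swap_lt !xpair_eqE.
  case: (eqVneq w u) => [->|_]; rewrite ?(negbTE uv) /= ?andbF /=; exact: incr.
- move=> w z g h g' h' E; rewrite !swap_lt.
  (* The difference [b] of two shifts arises from [b] and 0 only, so [(g, h)] belongs to the
     exchanged pair iff [(g', h')] does; likewise for [-b] below. *)
  have same w1 z1 : ((w, g) == (w1, ord_max)) && ((z, h) == (z1, ord0)) =
                    ((w, g') == (w1, ord_max)) && ((z, h') == (z1, ord0)).
    rewrite !xpair_eqE -!(inj_eq val_inj) /=.
    have := ltn_ord g; have := ltn_ord g'; have := ltn_ord h; have := ltn_ord h'.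
    by case: (w == w1) => //=; case: (z == z1); rewrite ?andbF //=; lia.
  have same' w1 z1 : ((w, g) == (w1, ord0)) && ((z, h) == (z1, ord_max)) =
                    ((w, g') == (w1, ord0)) && ((z, h') == (z1, ord_max)).
    rewrite !xpair_eqE -!(inj_eq val_inj) /=.
    have := ltn_ord g; have := ltn_ord g'; have := ltn_ord h; have := ltn_ord h'.
    by case: (w == w1) => //=; case: (z == z1); rewrite ?andbF //=; lia.
  by rewrite same same' (shift _ _ _ _ _ _ E).
Qed.

(** The measure that makes the exchanges terminate: for [b > 0] each one removes the pair [(u, v)]
    and adds none. *)
Definition far (pos : letter -> R) : nat :=
  #|[pred q : 'I_n * 'I_n | (q.1 != q.2) && (pos (q.1, ord_max) < pos (q.2, ord0))]|.

Hypothesis notD : ~~ D u v.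

Lemma swap_agree : (0 < b)%N -> agree swapped pos.
Proof.
move=> b0 w z g wz cmp; rewrite swap_lt.
case: andP => [[/eqP[e1 e2] /eqP[e3]]|_].
  by move: cmp; rewrite /compared e1 e2 e3 /= ltnn (negbTE notD).
(* The inequality created by the exchange has [(u, b)] on the right, whereas [agree] has only
   letters of shift 0 there. *)
case: andP => // -[_ /eqP[_ e]]; by rewrite -e in b0.
Qed.

Lemma swap_far : (0 < b)%N -> (far swapped < far pos)%N.
Proof.
move=> b0; apply: proper_card; apply/properP; split.
  apply/fintype.subsetP => -[w z]; rewrite !inE /= swap_lt.
  case: ifP => //; first by rewrite andbF.
  case: ifP => // /andP[_ /eqP[_ e]]; by rewrite -e in b0.
by exists (u, v); rewrite !inE /= ?swap_lt ?eqxx ?andbF // uv; case: pred_v.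
Qed.

End Swap.

Lemma exists_agree_last_slot_ok pos : valid pos ->
  (0 < b)%N \/ (forall u v, D u v) ->
  exists pos' p, [/\ valid pos', agree pos' pos,
    forall v, is_pred pos' v (p v) & last_slot_ok p].
Proof.
move=> + bD; have [N] := ubnP (far pos).
elim: N pos => // N IH pos; rewrite ltnS => leN V.
have [p pP] := exists_pred V.
have [ok|bad] := pselect (last_slot_ok p); first by exists pos, p; split.
have [v [u [pv nD]]] : exists v u, p v = Some (u, ord_max) /\ ~ D u v.
  apply: contra_notP bad => H v u pv; apply: contra_notT H => nD.
  by exists v, u; split=> //; apply/negP.
case: bD => [b0|allD]; last by case: nD.
move/negP: nD => nD; have := pP v; rewrite pv => predv.
have uv : u != v.
  by apply: contraTneq (parent_rank V predv) => ->; rewrite ltnn.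
have sV := swap_valid V uv predv.
case: (IH _ (leq_trans (swap_far V uv predv b0) leN) sV) => pos' [p' [V' ag P' ok]].
exists pos', p'; split=> // w z g wz cmp; rewrite ag //.
exact: (swap_agree V uv predv nD b0).
Qed.

End LetterOrders.

(** * Realization of trees by points *)

(** A height growing from parent to child excludes cycles and is also the measure for induction and
    recursion. *)
Definition acyclic_parent n (S : Type) (f : 'I_n -> option ('I_n * S)) : Prop :=
  exists h : 'I_n -> nat, forall v u s, f v = Some (u, s) -> (h u < h v)%N.

Lemma parent_rec n (S T : Type) (f : 'I_n -> option ('I_n * S))
    (base : 'I_n -> T) (step : S -> T -> T) : acyclic_parent f ->
  exists F : 'I_n -> T,
    forall v, F v = if f v is Some (u, s) then step s (F u) else base v.
Proof.
case=> h hP.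
(* Recursion on a fuel [k]: once [k] reaches the height of [v], more fuel does not change the value.
   The default at fuel 0 is right at height 0, where there is no parent. *)
pose G := fix G k v : T := if k is k'.+1 then
  (if f v is Some (u, s) then step s (G k' u) else base v) else base v.
have GE k k' v : (h v <= k)%N -> (h v <= k')%N -> G k v = G k' v.
  elim: k k' v => [|k IH] [|k'] v //=; case fv: (f v) => [[u s]|] // hk hk';
    have := hP _ _ _ fv => lt.
  - by have := leq_trans lt hk.
  - by have := leq_trans lt hk'.
  by congr step; apply: IH; [exact: leq_trans lt hk|exact: leq_trans lt hk'].
exists (fun v => G (h v) v) => v; case fv: (f v) => [[u s]|]; last first.
  by case: (h v) => [|k] //=; rewrite fv.
have := hP _ _ _ fv; case hv: (h v) => [|k] //; rewrite ltnS => le /=.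
by rewrite fv; congr step; apply: GE.
Qed.

Section Realization.
Local Open Scope ring_scope.
Variables (R : realFieldType) (n b : nat).

Definition real_pos (x : 'I_n -> R) (l : 'I_n * 'I_b.+1) : R :=
  x l.1 + (l.2 : nat)%:R.

Lemma nat_frac (m m' : nat) (e e' : R) : 0 <= e < 1 -> 0 <= e' < 1 ->
  (m%:R + e < m'%:R + e') = (m < m')%N || ((m == m') && (e < e')).
Proof.
move=> /andP[e0 e1] /andP[e'0 e'1]; case: (ltngtP m m') => [lt|gt|->] /=.
- have : m.+1%:R <= m'%:R :> R by rewrite ler_nat.
  by rewrite -natr1 => ?; lra.
- have : m'.+1%:R <= m%:R :> R by rewrite ler_nat.
  by rewrite -natr1 => ?; apply/negbTE; rewrite -leNgt; lra.
- by rewrite ltrD2l.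
Qed.

Lemma nat_frac_inj (m m' : nat) (e e' : R) : 0 <= e < 1 -> 0 <= e' < 1 ->
  m%:R + e = m'%:R + e' -> m = m' /\ e = e'.
Proof.
move=> he he' E; have := nat_frac m m' he he'; have := nat_frac m' m he' he.
rewrite E ltxx; case: ltngtP => //= mm _ _; split=> //.
by move: E; rewrite mm => /addrI.
Qed.

(* The order of these fractions is the lexicographic order of the paths from the
   root in a traversal that visits each vertex before its children, and the
   children in decreasing order of their slots. *)
Fixpoint path_frac (s : seq nat) : R :=
  if s is g :: s' then ((b.+1 - g)%:R + path_frac s') / b.+2%:R else 0.

Lemma path_frac01 s : 0 <= path_frac s < 1.
Proof.
elim: s => [|g s /andP[IH0 IH1]] /=; first by rewrite lexx ltr01.
have : (b.+1 - g)%:R <= b.+1%:R :> R by rewrite ler_nat leq_subr.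
move=> ?; apply/andP; split; first by apply: divr_ge0 => //; exact: addr_ge0.
rewrite ltr_pdivrMr ?ltr0n // mul1r.
by rewrite -[b.+2%:R]natr1; lra.
Qed.

Lemma path_frac_lt g s h t :
  (path_frac (g :: s) < path_frac (h :: t)) =
  (b.+1 - g < b.+1 - h)%N ||
    ((b.+1 - g == b.+1 - h)%N && (path_frac s < path_frac t)).
Proof.
by rewrite /= ltr_pM2r ?invr_gt0 ?ltr0n // nat_frac // path_frac01.
Qed.

Lemma path_frac_gt0 g s : (g <= b)%N -> 0 < path_frac (g :: s).
Proof.
move=> gb; have /andP[s0 _] := path_frac01 s.
by rewrite /= divr_gt0 ?ltr0n // ltr_wpDr // ltr0n subn_gt0 ltnS.
Qed.

(** The digits [b + 1 - g] in base [b + 2] are never 0, so only the empty path has value 0 and the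
    digits can be read off. *)
Lemma path_frac_inj s t : all (fun g => g <= b)%N s ->
  all (fun g => g <= b)%N t -> path_frac s = path_frac t -> s = t.
Proof.
elim: s t => [|g s IH] [|h t] //.
- by move=> _ /andP[hb _] E; have := path_frac_gt0 t hb; rewrite -E ltxx.
- by move=> /andP[gb _] _ E; have := path_frac_gt0 s gb; rewrite E ltxx.
move=> /= /andP[gb sb] /andP[hb tb].
have ne : b.+2%:R != 0 :> R by rewrite pnatr_eq0.
move=> /(mulIf (invr_neq0 ne)) /nat_frac_inj[||E /(IH _ sb tb) ->]; rewrite ?path_frac01 //.
by congr (_ :: _); lia.
Qed.

Lemma path_frac_rcons s g : (g <= b)%N -> path_frac s < path_frac (rcons s g).
Proof.
move=> gb; elim: s => [|h s IH]; first exact: path_frac_gt0.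
by rewrite rcons_cons path_frac_lt eqxx IH orbT.
Qed.

(** What the traversal visits between a vertex and its child in slot [g] lies below a child in a
    larger slot, whence the larger sum of slots. *)
Lemma path_frac_between s t g : (g <= b)%N -> all (fun g => g <= b)%N t ->
  path_frac s < path_frac t -> path_frac t < path_frac (rcons s g) ->
  (sumn s + g < sumn t)%N.
Proof.
move=> gb; elim: s t => [|h s IH] [|k t]; rewrite ?ltxx //.
- move=> /andP[kb tb] _; rewrite [rcons _ _]/= path_frac_lt => /orP[|/andP[_]] /=.
    by move=> lt; rewrite add0n ltn_addr //; lia.
  by rewrite ltNge; case/andP: (path_frac01 t) => ->.
- by move=> _; rewrite [path_frac [::]]/= ltNge; case/andP: (path_frac01 (h :: s)) => ->.
rewrite rcons_cons !path_frac_lt /= => /andP[kb tb].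
move=> /orP[lt|/andP[/eqP E lt]] /orP[lt'|/andP[/eqP E' lt']]; try lia.
by have := IH _ tb lt lt'; lia.
Qed.

Lemma exists_real_pos (p : 'I_n -> option ('I_n * 'I_b.+1)) :
  injective p -> acyclic_parent p ->
  exists x : 'I_n -> R, valid (real_pos x) /\ forall v, is_pred (real_pos x) v (p v).
Proof.
move=> p_inj acy.
have [P PE] := parent_rec (fun=> [::]) (fun (g : 'I_b.+1) s => rcons s (g : nat)) acy.
have [h hP] := acy.
have Pb v : all (fun g => g <= b)%N (P v).
  have [N] := ubnP (h v); elim: N v => // N IH v; rewrite ltnS => le.
  rewrite PE; case pv: (p v) => [[u g]|] //.
  rewrite all_rcons -ltnS ltn_ord IH //; exact: leq_trans (hP _ _ _ pv) le.
have P_inj : injective P.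
  move=> v; have [N] := ubnP (h v); elim: N v => // N IH v; rewrite ltnS => le w.
  have := PE v; have := PE w.
  case pv: (p v) => [[u g]|]; case pw: (p w) => [[u' g']|] -> ->.
  - move=> /rcons_inj[/IH eu /val_inj eg]; apply: p_inj.
    by rewrite pv pw eg eu //; exact: leq_trans (hP _ _ _ pv) le.
  - by case: (P u).
  - by case: (P u').
  - by move=> _; apply: p_inj; rewrite pv.
(* The integer part adds up the slots on the path, so a child in slot [g] of [u] has the same
   integer part as the letter [(u, g)] and a slightly larger fraction. *)
pose x v : R := (sumn (P v))%:R + path_frac (P v).
have xE v (g : 'I_b.+1) : real_pos x (v, g) = (sumn (P v) + g)%:R + path_frac (P v).
  by rewrite /real_pos /x /= natrD addrAC.
exists x; split.
  split.
  - move=> [u g] [v k]; rewrite !xE => /nat_frac_inj[||E /path_frac_inj]; rewrite ?path_frac01 //.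
    move=> /(_ (Pb _) (Pb _)) /P_inj euv; congr (_, _) => //.
    by apply/val_inj/eqP; rewrite -(eqn_add2l (sumn (P u))) E euv.
  - by move=> u g k gk; rewrite ltrD2l ltr_nat.
  - move=> u v g k g' k' /(congr1 (fun i => i%:R : R)); rewrite !natrD /real_pos /= => E.
    by apply/idP/idP; lra.
move=> v; have := PE v; case pv: (p v) => [[u g]|] /= Pv; last first.
  move=> [w k]; rewrite -leNgt !xE Pv /= !addr0.
  by apply: addr_ge0; [exact: ler0n|case/andP: (path_frac01 (P w))].
have gb : (g <= b)%N by rewrite -ltnS ltn_ord.
split=> [|[w k]].
  by rewrite !xE Pv sumn_rcons addn0 ltrD2l path_frac_rcons.
rewrite !xE Pv sumn_rcons addn0 nat_frac ?path_frac01 // => /orP[lt|/andP[/eqP E lt]].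
  by rewrite leNgt nat_frac ?path_frac01 // ltnNge ltnW //= negb_and gtn_eqF.
(* A letter strictly between [(u, g)] and [(v, 0)] would belong to a vertex whose slot sum alone
   exceeds their common integer part. *)
rewrite E lerD2l leNgt; apply/negP => lt'.
by have := path_frac_between gb (Pb w) lt' lt; rewrite -E; lia.
Qed.

End Realization.

(** * From trees to forests of slots *)

Lemma card_in_can (T T' : finType) (P : pred T) (Q : pred T') (f : T -> T')
    (g : T' -> T) : (forall x, P x -> Q (f x)) -> (forall x, P x -> g (f x) = x) ->
  (forall y, Q y -> P (g y)) -> (forall y, Q y -> f (g y) = y) -> #|P| = #|Q|.
Proof.
move=> PQ fK QP gK; rewrite -(@card_in_image _ _ f P); last first.
  by move=> x y Px Py /(congr1 g); rewrite !fK.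
apply: eq_card => y; apply/idP/idP => [/fintype.imageP[x Px ->]|Qy]; first exact: PQ.
by apply/fintype.imageP; exists (g y); [exact: QP|rewrite gK].
Qed.

Section Chaining.
Variables (n b : nat) (D R2 : rel 'I_n).

Local Notation slot_map := {ffun 'I_n -> option ('I_n * 'I_b.+1)}.

(* Interpolates between trees (all vertices in A: at most one child per slot) and
   forests with an unbounded number of children per slot (A empty). *)
Definition mixed (A : pred 'I_n) (f : slot_map) : bool :=
  `[< [/\ acyclic_parent f, {in A &, injective f} &
      forall x u, f x = Some (u, ord_max) ->
        if A x then A u && D u x else R2 u x] >].

(* v takes over its slot, and the vertex of A that occupied it moves to slot b of v. *)
Definition attach (A : pred 'I_n) (v : 'I_n) (f : slot_map) : slot_map :=
  [ffun x => if [&& x != v, A x & f x == f v] then Some (v, ord_max) else f x].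

Definition detach (A : pred 'I_n) (v : 'I_n) (f : slot_map) : slot_map :=
  [ffun x => if A x && (f x == Some (v, ord_max)) then f v else f x].

Variables (A A' : pred 'I_n) (v : 'I_n).
Hypothesis AE : forall x, A' x = A x || (x == v).
Hypothesis vA : ~~ A v.
Hypothesis R2v : forall u, u != v -> R2 u v = A u && D u v.
Hypothesis Dv : forall x, A x -> D v x.
Hypothesis R2D : forall u x, R2 u v -> A x -> D u x.

Lemma acyclic_neq (f : slot_map) x u s : acyclic_parent f -> f x = Some (u, s) -> u != x.
Proof. by case=> h hP /hP; apply: contraTneq => ->; rewrite ltnn. Qed.

(** Slot [b] of [v] is free for the moved vertex: a vertex of [A] in a slot [b] has its parent in
    [A], and [v] is outside [A]. Being a root counts as a slot here: if [v] is a root, a root in [A]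
    moves below it. *)
Lemma mixed_attach f : mixed A f -> mixed A' (attach A v f).
Proof.
move=> /asboolP[acy inj cond]; apply/asboolP.
have fv_neq s : f v <> Some (v, s).
  by move=> /(acyclic_neq acy); rewrite eqxx.
have fvE : attach A v f v = f v by rewrite ffunE eqxx.
split.
- case: acy => h hP.
  (* Doubling makes room for [v] immediately above the height of its parent, hence below its new
     child; a root [v] goes below all other heights. *)
  exists (fun x => if x == v then (if f v is Some (u, _) then (h u).*2.+3 else 1)
                   else (h x).*2.+2) => x u s.
  rewrite ffunE; case: ifP => [/and3P[xv _ /eqP fx] [<- _]|_ fx].
    rewrite eqxx (negbTE xv); case fv: (f v) => [[w t]|] //.
    by have := hP x w t; rewrite fx fv => /(_ erefl); lia.
  have lt := hP _ _ _ fx; have ux : u != x by apply: contraTneq lt => ->; rewrite ltnn.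
  case: (eqVneq x v) ux fx => [->|xv] ux fx; first by rewrite (negbTE ux) fx; lia.
  case: (eqVneq u v) lt => [->|_] lt; last by lia.
  case fv: (f v) => [[w t]|]; last by lia.
  by have := hP _ _ _ fv; lia.
- have main x y : A x -> A y || (y == v) -> attach A v f x = attach A v f y -> x = y.
    move=> Ax Ay; have xv : x != v by apply: contraTneq Ax => ->.
    rewrite !ffunE Ax xv /=; case: (eqVneq y v) Ay => [-> _ /=|yv].
      by case: eqP => // ne; move=> /esym/fv_neq.
    rewrite orbF => Ay; rewrite Ay /=.
    case: eqP => fx; case: eqP => fy; last exact: inj.
    + by move=> _; apply: inj => //; rewrite fx fy.
    + by move=> /esym/cond; rewrite Ay (negbTE vA).
    + by move=> /cond; rewrite Ax (negbTE vA).
  move=> x y; rewrite !unfold_in !AE => /orP[Ax|/eqP->]; first exact: main.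
  move=> /orP[Ay|/eqP-> //] E; apply/esym/main => //; by rewrite eqxx orbT.
- move=> x u; rewrite ffunE !AE; case: ifP => [/and3P[xv Ax _] [<-]|].
    by rewrite Ax eqxx orbT Dv.
  move=> _ fx; have ux := acyclic_neq acy fx.
  case: (eqVneq x v) fx ux => [->|xv] fx ux.
    have := cond _ _ fx; rewrite (negbTE vA) /= R2v // => /andP[-> ->]//.
  by have := cond _ _ fx; rewrite orbF; case: (A x) => // /andP[-> ->].
Qed.

Lemma mixed_detach f : mixed A' f -> mixed A (detach A v f).
Proof.
move=> /asboolP[acy inj cond]; apply/asboolP.
have AA' x : A x -> A' x by rewrite AE => ->.
have fv_neq s : f v <> Some (v, s).
  by move=> /(acyclic_neq acy); rewrite eqxx.
split.
- case: acy => h hP; exists h => x u s; rewrite ffunE.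
  case: ifP => [/andP[Ax /eqP fx] fv|_]; last exact: hP.
  exact: ltn_trans (hP _ _ _ fv) (hP _ _ _ fx).
- move=> x y Ax Ay; rewrite !unfold_in in Ax Ay; rewrite !ffunE Ax Ay /=.
  have neq z : A z -> f z = f v -> z = v.
    by move=> Az; apply: inj; rewrite unfold_in AE ?Az ?eqxx ?orbT.
  case: eqP => fx; case: eqP => fy E.
  + by apply: inj; rewrite ?fx ?fy //; apply: AA'.
  + by move: vA; rewrite -(neq y Ay (esym E)) Ay.
  + by move: vA; rewrite -(neq x Ax E) Ax.
  + by apply: inj => //; apply: AA'.
- move=> x u; rewrite ffunE.
  have vcase w : f v = Some (w, ord_max) -> A w /\ D w v.
    move=> fv; have wv := acyclic_neq acy fv; have := cond _ _ fv.
    by rewrite !AE eqxx orbT (negbTE wv) orbF => /andP[].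
  case: ifP => [/andP[Ax /eqP fx] fv|].
    (* Here [x] leaves slot [b] of [v] for slot [b] of [u], and [R2D] supplies the required
       [D u x]. *)
    have [Au Duv] := vcase _ fv; rewrite Ax Au /=.
    by apply: (@R2D u x) => //; rewrite R2v ?Au //; exact: acyclic_neq fv.
  move=> /negbT; rewrite negb_and => nchg fx.
  move: (cond _ _ fx) nchg; rewrite !AE; case: (boolP (A x)) => [Ax|nAx] /=.
    by rewrite fx => /andP[/orP[->->//|/eqP->] _]; rewrite eqxx.
  move=> + _; case: (eqVneq x v) fx => [->|//] fx _.
  have [Au Duv] := vcase _ fx; rewrite R2v ?Au //; exact: acyclic_neq fx.
Qed.

Lemma attachK f : mixed A f -> detach A v (attach A v f) = f.
Proof.
move=> /asboolP[acy inj cond]; apply/ffunP => x; rewrite !ffunE eqxx /=.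
case: (eqVneq x v) => [->|xv] /=; first by rewrite (negbTE vA).
case Ax: (A x) => //=; case: (f x =P f v) => [->|_]; first by rewrite eqxx.
(* No vertex of [A] was in slot [b] of [v] before, so only what was moved is moved back. *)
by case: eqP => // /cond; rewrite Ax (negbTE vA).
Qed.

Lemma detachK f : mixed A' f -> attach A v (detach A v f) = f.
Proof.
move=> /asboolP[acy inj cond]; apply/ffunP => x; rewrite !ffunE (negbTE vA) /=.
case: (eqVneq x v) => [->|xv] /=; first by rewrite (negbTE vA).
case Ax: (A x) => //=; case: (f x =P Some (v, ord_max)) => [->|_]; first by rewrite eqxx.
(* By injectivity on [A'] no vertex of [A] shares the slot of [v], so [attach] catches only the
   vertex just moved there. *)
case: eqP => // E; have := inj x v; rewrite !unfold_in !AE Ax eqxx orbT.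
by move=> /(_ isT isT E) e; rewrite e eqxx in xv.
Qed.

Lemma card_mixed_step : #|mixed A| = #|mixed A'|.
Proof.
apply: (@card_in_can _ _ _ _ (attach A v) (detach A v)).
- exact: mixed_attach.
- exact: attachK.
- exact: mixed_detach.
- exact: detachK.
Qed.

End Chaining.

(** The vertices enter [A] in increasing order of [sigma]. When [v] enters, [A] consists of the [x]
    with [sigma x < sigma v], and the hypotheses become those of a single step. *)
Lemma card_mixed_chain n b (D R2 : rel 'I_n) (sigma : 'I_n -> 'I_n) :
  involutive sigma ->
  (forall u v, u != v -> R2 u v = (sigma u < sigma v)%N && D u v) ->
  (forall v x, (sigma x < sigma v)%N -> D v x) ->
  (forall u v x, R2 u v -> (sigma x < sigma v)%N -> D u x) ->
  #|@mixed n b D R2 pred0| = #|@mixed n b D R2 predT|.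
Proof.
move=> sK H1 H2 H3.
have H k : (k <= n)%N ->
    #|@mixed n b D R2 pred0| = #|@mixed n b D R2 (fun x => sigma x < k)%N|.
  elim: k => [|k IH] kn; first by congr #|@mixed _ _ _ _ _|; apply: funext.
  rewrite IH 1?ltnW //; apply: (@card_mixed_step _ _ _ _ _ _ (sigma (Ordinal kn))).
  - by move=> x; rewrite ltnS leq_eqVlt orbC -(inj_eq (inv_inj sK)) sK.
  - by rewrite sK /= ltnn.
  - by move=> u uv; rewrite H1 // sK.
  - by move=> x lt; apply: H2; rewrite sK.
  - by move=> u x R2u lt; apply: (H3 _ _ _ R2u); rewrite sK.
rewrite (H n) //; congr #|@mixed _ _ _ _ _|; apply: funext => x /=.
by rewrite ltn_ord.
Qed.

(** * Forests as parent maps *)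

Lemma acyclic_ind n (S : Type) (f : 'I_n -> option ('I_n * S)) (P : 'I_n -> Prop) :
  acyclic_parent f ->
  (forall v, (forall u s, f v = Some (u, s) -> P u) -> P v) -> forall v, P v.
Proof.
case=> h hP step v; have [N] := ubnP (h v); elim: N v => // N IH v.
rewrite ltnS => le; apply: step => u s fv; apply: IH.
exact: leq_trans (hP _ _ _ fv) le.
Qed.

Section ForestEncoding.
Variables (alpha beta n : nat).

Local Notation tree := (wtree alpha beta n).
Local Notation pmap := {ffun 'I_n -> option ('I_n * 'I_(maxn alpha beta).+1)}.

Definition pedge (q : pmap) : rel 'I_n :=
  fun u v => if q v is Some (i, _) then i == u else false.

Definition admissible (q : pmap) : bool :=
  `[< acyclic_parent q /\ forall v u k, q v = Some (u, k) ->
        1 <= k <= (if u < v then alpha else beta) >].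

Definition tree_at (q : pmap) (r : 'I_n) : tree :=
  ([set v | connect (pedge q) r v]%SET, r,
   [ffun ij => if connect (pedge q) r ij.1 then
      (if q ij.2 is Some (i, k) then if i == ij.1 then Some k else None else None)
      else None]).

Definition forest_of (q : pmap) : {set tree} :=
  [set tree_at q r | r in [pred r | q r == None]]%SET.

Definition pmap_of (F : {set tree}) : pmap :=
  [ffun j => [pick ik | [exists t in F, weight t ik.1 j == Some ik.2]]].

Lemma pedgeP (q : pmap) u v : reflect (exists k, q v = Some (u, k)) (pedge q u v).
Proof.
rewrite /pedge; case: (q v) => [[i k]|]; last by constructor; case.
apply: (iffP eqP) => [->|[k' [-> _]]] //; by exists k.
Qed.

Lemma weight_tree_at (q : pmap) r i j k :
  weight (tree_at q r) i j = Some k <->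
  connect (pedge q) r i /\ q j = Some (i, k).
Proof.
rewrite /weight /tree_at /= ffunE /=; case: connect; last by split=> // -[].
case: (q j) => [[i' k']|]; last by split=> // -[].
case: (eqVneq i' i) => [->|/eqP ne]; first by split=> [[->]|[_ [->]]].
by split=> // -[_ [e]]; case: ne.
Qed.

Lemma parent_tree_at (q : pmap) r i j :
  parent (tree_at q r) i j = connect (pedge q) r i && pedge q i j.
Proof.
rewrite /parent; case E: (weight _ i j) => [k|]; symmetry.
  by move/weight_tree_at: E => [-> qj]; apply/pedgeP; exists k.
apply/negbTE/negP => /andP[ri /pedgeP[k qj]].
by move: E; rewrite (proj2 (weight_tree_at q r i j k)).
Qed.

Section FromMap.
Variable q : pmap.
Hypothesis q_acy : acyclic_parent q.

Lemma exists_root :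
  exists rt : 'I_n -> 'I_n, forall v,
    [/\ q (rt v) = None, connect (pedge q) (rt v) v &
        forall u, connect (pedge q) u v -> rt u = rt v].
Proof.
have [rt rtE] := parent_rec id (fun _ r => r) q_acy.
exists rt => v; split.
- move: v; apply: (acyclic_ind q_acy) => v IH; rewrite rtE.
  by case qv: (q v) => [[u s]|] //; apply: IH qv.
- move: v; apply: (acyclic_ind q_acy) => v IH; rewrite rtE.
  case qv: (q v) => [[u s]|]; last exact: connect0.
  by apply: connect_trans (IH _ _ qv) (connect1 _); apply/pedgeP; exists s.
move=> u /connectP[s]; elim: s u => [|w s IH] u /=; first by move=> _ ->.
move=> /andP[/pedgeP[k qw] /IH{}IH] /IH <-; by rewrite [RHS]rtE qw.
Qed.

Lemma root_unique r r' v : q r = None -> q r' = None ->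
  connect (pedge q) r v -> connect (pedge q) r' v -> r = r'.
Proof.
have [rt H] := exists_root => qr qr' rv r'v.
have fixr s : q s = None -> rt s = s.
  move=> qs; have [_ /connectP[p pth e] _] := H s.
  move: pth e; case/lastP: p => [_ /= /esym//|p x].
  rewrite last_rcons rcons_path => /andP[_ /pedgeP[k E]] es.
  by move: E; rewrite -es qs.
have [_ _ Hv] := H v; by rewrite -(fixr r) // -(fixr r') // Hv // Hv.
Qed.

Lemma tree_at_rooted r : q r = None -> is_rooted_tree (tree_at q r).
Proof.
move=> qr; apply/and4P; split.
- by rewrite !inE connect0.
- apply/forallP => i; apply/forallP => j; apply/implyP.
  rewrite parent_tree_at !inE => /andP[ri ij].
  by rewrite ri (connect_trans ri (connect1 ij)).
- apply/forallP => j; apply/implyP; rewrite inE => rj.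
  rewrite -[troot _]/r; case: (eqVneq j r) => [->|/= jr].
    apply/eqP/eq_card0 => i; rewrite !inE parent_tree_at.
    by apply/negbTE/negP => /andP[_ /pedgeP[k]]; rewrite qr.
  case/connectP: rj; case/lastP => [_ /= e|p x]; first by rewrite e eqxx in jr.
  rewrite last_rcons rcons_path => /andP[rp px] e; rewrite -{}e in px.
  apply/eqP; rewrite -(card1 (last r p)); apply: eq_card => i; rewrite !inE.
  rewrite parent_tree_at; apply/andP/eqP => [[_ /pedgeP[k qj]]|->].
    by case/pedgeP: px => k'; rewrite qj => -[].
  by split=> //; apply/connectP; exists p.
- apply/forallP => j; apply/implyP; rewrite inE => /connectP[p rp ->].
  elim/last_ind: p rp => [|p x IH]; first by rewrite connect0.
  rewrite rcons_path last_rcons => /andP[rp px].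
  apply: connect_trans (IH rp) (connect1 _); rewrite parent_tree_at px andbT.
  by apply/connectP; exists p.
Qed.

End FromMap.

Lemma forest_of_forest q : admissible q -> is_forest (forest_of q).
Proof.
move=> /asboolP[acy wt]; apply/and3P; split.
- apply/forallP => t; apply/implyP => /imsetP[r /eqP qr ->].
  rewrite tree_at_rooted //=; apply/forallP => i; apply/forallP => j.
  case E: (weight _ i j) => [k|] //; move/weight_tree_at: E => [_]; exact: wt.
- apply/dinjectiveP => _ _ /imsetP[r /eqP qr ->] /imsetP[r' /eqP qr' ->] E.
  congr tree_at; apply: (root_unique acy qr qr' (connect0 _ r)).
  have : r \in verts (tree_at q r) by rewrite inE connect0.
  by rewrite E inE.
- apply/and3P; split.
  + apply/eqP/setP => v; rewrite inE; have [rt H] := exists_root acy.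
    have [qr rv _] := H v; apply/bigcupP; exists (verts (tree_at q (rt v))).
      by apply/imset_f/imset_f; rewrite inE qr.
    by rewrite inE.
  + apply/finset.trivIsetP => _ _ /imsetP[_ /imsetP[r /eqP qr ->] ->]
      /imsetP[_ /imsetP[r' /eqP qr' ->] ->] ne.
    rewrite -setI_eq0; apply: contraNT ne => /set0Pn[v]; rewrite !inE => /andP[rv r'v].
    by rewrite (root_unique acy qr qr' rv r'v).
  + apply/imsetP => -[_ /imsetP[r _ ->] /setP/(_ r)].
    by rewrite !inE connect0.
Qed.

Lemma pmap_of_forest_of q : admissible q -> pmap_of (forest_of q) = q.
Proof.
move=> /asboolP[acy wt]; apply/ffunP => j; rewrite ffunE.
have [rt H] := exists_root acy.
case: pickP => [[i k] /existsP[t /andP[/imsetP[r _ ->] /eqP]]|none].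
  by move=> /weight_tree_at[_ ->].
case qj: (q j) => [[i k]|] //; have := none (i, k); move/negbT/existsP => [].
have [qr ri _] := H i; exists (tree_at q (rt i)).
by rewrite imset_f ?inE ?qr //=; apply/eqP/weight_tree_at.
Qed.

Section FromForest.
Variable F : {set tree}.
Hypothesis F_forest : is_forest F.

Let F_tree t : t \in F -> is_rooted_tree t && weights_ok t.
Proof. by case/and3P: F_forest => /forallP/(_ t)/implyP. Qed.

Let verts_unique t t' v : t \in F -> t' \in F ->
  v \in verts t -> v \in verts t' -> t = t'.
Proof.
case/and3P: F_forest => _ /dinjectiveP inj /and3P[_ /finset.trivIsetP triv _].
move=> tF t'F vt vt'; apply: inj => //; apply/eqP.
case: eqVneq => // ne.
have := triv _ _ (imset_f (@verts _ _ _) tF) (imset_f (@verts _ _ _) t'F) ne.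
by rewrite -setI_eq0 => /eqP/setP/(_ v); rewrite !inE vt vt'.
Qed.

Let weight_verts t i j k : t \in F -> weight t i j = Some k ->
  (i \in verts t) /\ (j \in verts t).
Proof.
move=> /F_tree/andP[/and4P[_ /forallP/(_ i)/forallP/(_ j)/implyP H _ _] _] E.
by apply/andP/H; rewrite /parent E.
Qed.

Let parent_unique t i i' j : t \in F -> parent t i j -> parent t i' j -> i = i'.
Proof.
move=> tF ij i'j; have := F_tree tF => /andP[/and4P[_ _ /forallP/(_ j)/implyP H _] _].
have [k wij] : exists k, weight t i j = Some k.
  by move: ij; rewrite /parent; case: (weight t i j) => // k _; exists k.
have [_ /H/eqP E] := weight_verts tF wij.
have : (#|[pred i | parent t i j]| <= 1)%N by rewrite E; case: ifP.
by move/card_le1_eqP => /(_ i i' ij i'j).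
Qed.

(** Disjointness of the trees and uniqueness of parents within a tree leave only one candidate for
    [pick]. *)
Lemma pmap_ofP j i k :
  pmap_of F j = Some (i, k) <-> exists2 t, t \in F & weight t i j = Some k.
Proof.
rewrite ffunE; split.
  by case: pickP => // -[i' k'] /existsP[t /andP[tF /eqP /= E]] [<- <-]; exists t.
move=> [t tF E]; case: pickP => [[i' k'] /existsP[t' /andP[t'F /eqP /= E']]|]; last first.
  by move=> /(_ (i, k))/existsP[]; exists t; rewrite tF E /=.
have [_ jt] := weight_verts tF E; have [_ jt'] := weight_verts t'F E'.
have e := verts_unique tF t'F jt jt'; rewrite -e in E'.
have ei : i = i' by apply: (@parent_unique t _ _ j) => //; rewrite /parent ?E ?E'.
by move: E; rewrite ei E' => -[->].
Qed.

Lemma pedge_pmap_of i j :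
  pedge (pmap_of F) i j <-> exists2 t, t \in F & parent t i j.
Proof.
split=> [/pedgeP[k /pmap_ofP[t tF E]]|[t tF]]; first by exists t; rewrite // /parent E.
rewrite /parent; case E: (weight t i j) => [k|] // _.
by apply/pedgeP; exists k; apply/pmap_ofP; exists t.
Qed.

Lemma pmap_of_root t : t \in F -> pmap_of F (troot t) = None.
Proof.
move=> tF; case E: (pmap_of F _) => [[i k]|] //; exfalso.
move/pmap_ofP: E => [t' t'F E].
have /andP[/and4P[rt _ /forallP/(_ (troot t))/implyP/(_ rt) H _] _] := F_tree tF.
have [_ rt'] := weight_verts t'F E; move: H; rewrite eqxx.
rewrite -(verts_unique tF t'F rt rt') in E.
by move=> /eqP/card0_eq/(_ i); rewrite !inE /parent E.
Qed.

(** A path from the root cannot leave [t], since an edge of another tree starting in [t] would give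
    the two trees a common vertex. *)
Lemma tree_connect t v : t \in F ->
  (v \in verts t) = connect (pedge (pmap_of F)) (troot t) v.
Proof.
move=> tF; have /andP[/and4P[rt _ _ /forallP/(_ v)/implyP H] _] := F_tree tF.
apply/idP/idP => [/H|/connectP[p + ->]].
  apply: connect_sub => i j ij; apply: connect1; apply/pedge_pmap_of.
  by exists t.
elim/last_ind: p => // p x IH; rewrite rcons_path last_rcons => /andP[/IH vt].
move=> /pedgeP[k /pmap_ofP[t' t'F E]]; have [it' xt'] := weight_verts t'F E.
by rewrite (verts_unique tF t'F vt it').
Qed.

Lemma exists_tree v : exists2 t, t \in F & v \in verts t.
Proof.
case/and3P: F_forest => _ _ /and3P[/eqP/setP/(_ v) + _ _]; rewrite inE.
by move=> /bigcupP[_ /imsetP[t tF ->] vt]; exists t.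
Qed.

(** Every vertex is reached from the root of its tree, so climbing to parents ends; the number of
    steps until [None] is the height. *)
Lemma pmap_of_acyclic : acyclic_parent (pmap_of F).
Proof.
pose up (o : option 'I_n) := obind (fun v => omap fst (pmap_of F v)) o.
have top v : exists k, iter k up (Some v) == None.
  have [t tF] := exists_tree v; rewrite tree_connect // => /connectP[p + ->].
  elim/last_ind: p => [_|p x IH].
    by exists 1; rewrite /= /up /= pmap_of_root.
  rewrite rcons_path last_rcons => /andP[/IH[k Hk] /pedgeP[m E]].
  by exists k.+1; rewrite iterSr {2}/up /= E.
exists (fun v => ex_minn (top v)) => v u s E.
case: (ex_minnP (top v)) => -[|k] // Hk _; case: ex_minnP => m _ min; rewrite ltnS; apply: min.
by move: Hk; rewrite iterSr {2}/up /= E.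
Qed.

Lemma pmap_of_admissible : admissible (pmap_of F).
Proof.
apply/asboolP; split; first exact: pmap_of_acyclic.
move=> v u k /pmap_ofP[t /F_tree/andP[_ /forallP/(_ u)/forallP/(_ v)] + E].
by rewrite E.
Qed.

Lemma tree_at_pmap_of t : t \in F -> tree_at (pmap_of F) (troot t) = t.
Proof.
move=> tF; have V v := tree_connect v tF.
rewrite [RHS]surjective_pairing [t.1 in RHS]surjective_pairing.
congr (_, _, _); first by apply/setP => v; rewrite inE -V.
apply/ffunP => -[i j]; rewrite -[RHS]/(weight t i j) -[LHS]/(weight (tree_at _ _) i j).
case E: (weight t i j) => [k|].
  have [it _] := weight_verts tF E; apply/weight_tree_at; rewrite -V it.
  by split=> //; apply/pmap_ofP; exists t.
case E': (weight (tree_at _ _) i j) => [k|] //.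
move/weight_tree_at: E'; rewrite -V => -[it /pmap_ofP[t' t'F E']].
have [it' _] := weight_verts t'F E'.
by move: E; rewrite (verts_unique tF t'F it it') E'.
Qed.

Lemma forest_of_pmap_of : forest_of (pmap_of F) = F.
Proof.
apply/setP => t; apply/imsetP/idP => [[r /eqP qr ->]|tF]; last first.
  by exists (troot t); rewrite ?inE ?pmap_of_root ?tree_at_pmap_of.
have [t' t'F rt'] := exists_tree r.
have -> : r = troot t'.
  apply: (root_unique pmap_of_acyclic qr (pmap_of_root t'F) (connect0 _ _)).
  by rewrite -tree_connect.
by rewrite tree_at_pmap_of.
Qed.

End FromForest.

Lemma num_forests_admissible : num_forests alpha beta n = #|admissible|.
Proof.
symmetry; apply: (@card_in_can _ _ _ _ forest_of pmap_of).
- exact: forest_of_forest.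
- exact: pmap_of_forest_of.
- exact: pmap_of_admissible.
- exact: forest_of_pmap_of.
Qed.

End ForestEncoding.

(** Weight [k] becomes slot [k - 1]; the hypothesis says that slot [b] is open to an edge from [u]
    to [v] exactly when [R2 u v]. The bounds [fb] and [gb] keep [inord] within range. *)
Lemma card_admissible_mixed n b alpha beta (D R2 : rel 'I_n) :
  (forall u v : 'I_n, u != v -> (if u < v then alpha else beta) = b + R2 u v) ->
  #|@admissible alpha beta n| = #|@mixed n b D R2 pred0|.
Proof.
move=> H.
pose f (q : {ffun 'I_n -> option ('I_n * 'I_(maxn alpha beta).+1)}) :=
  [ffun v => omap (fun uk : 'I_n * 'I_(maxn alpha beta).+1 =>
                     (uk.1, inord (uk.2 : nat).-1 : 'I_b.+1)) (q v)].
pose g (p : {ffun 'I_n -> option ('I_n * 'I_b.+1)}) :=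
  [ffun v => omap (fun uk : 'I_n * 'I_b.+1 =>
                     (uk.1, inord (uk.2 : nat).+1 : 'I_(maxn alpha beta).+1)) (p v)].
have Hq (q : {ffun 'I_n -> option ('I_n * 'I_(maxn alpha beta).+1)}) v u k :
    admissible q -> q v = Some (u, k) -> 0 < k <= b + R2 u v.
  move=> /asboolP[acy wt] E; rewrite -H; first exact: wt.
  exact: acyclic_neq acy E.
have Hp (p : {ffun 'I_n -> option ('I_n * 'I_b.+1)}) v u k :
    mixed D R2 pred0 p -> p v = Some (u, k) -> k.+1 <= (if u < v then alpha else beta).
  move=> /asboolP[acy _ cond] E; rewrite H; last exact: acyclic_neq acy E.
  have := ltn_ord k; rewrite ltnS leq_eqVlt => /orP[/eqP kb|]; last exact: ltn_addr.
  have -> : R2 u v.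
    by apply: (cond v u); rewrite E; congr (Some (_, _)); exact: val_inj.
  by rewrite addn1 kb.
have le_max u v : (if (u : 'I_n) < (v : 'I_n) then alpha else beta) <= maxn alpha beta.
  by case: ifP; rewrite ?leq_maxl ?leq_maxr.
have fb (q : {ffun 'I_n -> option ('I_n * 'I_(maxn alpha beta).+1)}) v u k :
    admissible q -> q v = Some (u, k) -> k.-1 < b.+1.
  by move=> qa E; have := Hq q v u k qa E; case: (R2 u v); lia.
have gb (p : {ffun 'I_n -> option ('I_n * 'I_b.+1)}) v u k :
    mixed D R2 pred0 p -> p v = Some (u, k) -> k.+1 < (maxn alpha beta).+1.
  by move=> pm E; rewrite ltnS; apply: leq_trans (Hp p v u k pm E) (le_max _ _).
apply: (@card_in_can _ _ _ _ f g).
- move=> q qa; have /asboolP[acy wt] := qa; apply/asboolP; split => //.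
    case: acy => h hP; exists h => v u s; rewrite ffunE.
    by case E: (q v) => [[w k]|] //= [<- _]; exact: hP E.
  move=> v u; rewrite ffunE /=; case E: (q v) => [[w k]|] //= [ew /(congr1 val)/=].
  rewrite inordK ?(fb q v w) // => kb; rewrite -ew.
  by have := Hq _ _ _ _ qa E; case: (R2 w v) => //; lia.
- move=> q qa; apply/ffunP => v; rewrite !ffunE; case E: (q v) => [[u k]|] //=.
  have /andP[k0 _] := Hq _ _ _ _ qa E.
  congr (Some (_, _)); apply/val_inj; rewrite /= [inord k.-1 : nat]inordK ?(fb q v u) // prednK //.
  by rewrite inordK.
- move=> p pm; have /asboolP[acy _ cond] := pm; apply/asboolP; split.
    case: acy => h hP; exists h => v u s; rewrite ffunE.
    by case E: (p v) => [[w k]|] //= [<- _]; exact: hP E.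
  move=> v u k; rewrite ffunE; case E: (p v) => [[w l]|] //= [<- <-].
  by rewrite inordK ?(gb p v w) //=; exact: Hp E.
- move=> p pm; apply/ffunP => v; rewrite !ffunE; case E: (p v) => [[u k]|] //=.
  congr (Some (_, _)); apply/val_inj; rewrite /= [inord k.+1 : nat]inordK ?(gb p v u) //=.
  by rewrite inordK.
Qed.

(** * Regions *)

Section Regions.
Local Open Scope classical_set_scope.
Local Open Scope ring_scope.
Variables (R : realType) (n b : nat) (D : rel 'I_n).

Definition generic : set 'rV[R]_n :=
  [set x | forall u v (g : 'I_b.+1), u != v -> compared D u v g ->
    x ord0 u + (g : nat)%:R != x ord0 v].

Local Notation pos x := (@real_pos R n b ((x : 'rV[R]_n) ord0)).

(** On a connected set the difference of two coordinates takes an interval of values; it avoids [g],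
    hence stays on one side of it. *)
Lemma component_agree (x y : 'rV[R]_n) :
  connected_component generic x y -> agree D (pos x) (pos y).
Proof.
move=> [C [Cx CM Cc] Cy] u v g uv cmp.
pose f (z : 'rV[R]_n) : R := z ord0 v - z ord0 u.
have f_cont : continuous f.
  move=> z; apply: (@continuousB _ R _ (fun z : 'rV[R]_n => z ord0 v)
    (fun z : 'rV[R]_n => z ord0 u) z); exact: coord_continuous.
have fC : is_interval (f @` C).
  apply/connected_intervalP/connected_continuous_connected => //.
  exact: continuous_subspaceT.
have fN z : C z -> f z = (g : nat)%:R -> False.
  move=> /CM/(_ u v g uv cmp) /eqP ne; rewrite /f => E; apply: ne.
  by rewrite -E addrC subrK.
have fE (z : 'rV[R]_n) : (pos z (u, g) < pos z (v, ord0)) = ((g : nat)%:R < f z).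
  by rewrite /real_pos /= addr0 ltrBrDl.
rewrite !fE; apply/idP/idP => lt; rewrite ltNge; apply/negP => le.
- have [z Cz /(fN z Cz)//] : (f @` C) (g : nat)%:R.
  by apply: (fC (f y) (f x)); [exists y|exists x|rewrite le ltW].
- have [z Cz /(fN z Cz)//] : (f @` C) (g : nat)%:R.
  by apply: (fC (f x) (f y)); [exists x|exists y|rewrite le ltW].
Qed.

(** The segment from [x] to [y] meets no hyperplane, because both ends lie on the same side of each
    one. *)
Lemma agree_component (x y : 'rV[R]_n) : generic x -> generic y ->
  agree D (pos x) (pos y) -> connected_component generic x = connected_component generic y.
Proof.
move=> Mx My ag; apply: same_connected_component.
pose f (t : R) := x + t *: (y - x).
have f_cont : continuous f.
  move=> t; apply: cvgD; first exact: cvg_cst.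
  exact: scalel_continuous.
apply: (@connected_component_max _ _ (f @` `[0, 1])).
- by exists 0; rewrite /= ?in_itv /= ?lexx ?ler01 // /f scale0r addr0.
- move=> z [t /=]; rewrite in_itv /= => /andP[t0 t1] <- u v g uv cmp.
  have := ag u v g uv cmp; have := Mx u v g uv cmp; have := My u v g uv cmp.
  rewrite /real_pos /= !addr0 /f !mxE.
  set p := x ord0 u; set q := x ord0 v; set p' := y ord0 u; set q' := y ord0 v.
  set k := _%:R => ne' ne E; apply/eqP => e.
  have conv A B : 0 < A -> 0 < B -> 0 < (1 - t) * A + t * B.
    move=> A0 B0; move: t0; rewrite le_eqVlt => /orP[/eqP<-|t0]; first by lra.
    by rewrite ltr_wpDl ?mulr_gt0 // mulr_ge0 ?subr_ge0 // ltW.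
  case: (ltgtP (p + k) q) ne E => // lt _ /esym lt'.
    by have := conv (q - (p + k)) (q' - (p' + k)); lra.
  have gt' : p' + k > q' by rewrite lt_neqAle eq_sym ne' leNgt lt'.
  by have := conv (p + k - q) (p' + k - q'); lra.
- apply: connected_continuous_connected; first exact: segment_connected.
  exact: continuous_subspaceT.
- by exists 1; rewrite /= ?in_itv /= ?lexx ?ler01 // /f scale1r addrC subrK.
Qed.

(* Shrinking x slightly makes it avoid the equalities x_u + b = x_v outside D. *)
Lemma generic_perturb (x : 'rV[R]_n) : (forall u v, compared D u v (ord0 : 'I_b.+1)) ->
  generic x -> exists2 y : 'I_n -> R, valid (@real_pos R n b y) &
    agree D (real_pos y) (pos x).
Proof.
move=> cmp0 Mx.
pose d (w : 'I_n * 'I_n) := x ord0 w.2 - x ord0 w.1.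
pose F (w : 'I_n * 'I_n * 'I_b.+1) := (w.2 : nat)%:R / d w.1.
(* The largest ratio [k / d] with [k < d]. Any scale [t] with [m < t < 1] keeps all inequalities
   [k < d] and turns equalities [d = k] with [k > 0] into [t * d < k]; [d = 0] is excluded for
   distinct vertices by [cmp0]. *)
pose m := \big[Num.max/0]_(w : 'I_n * 'I_n * 'I_b.+1 | ((w.2 : nat)%:R : R) < d w.1) F w.
have m0 : 0 <= m by exact: bigmax_ge_id.
have m1 : m < 1.
  apply: bigmax_lt => // w lt; have d0 : 0 < d w.1 := le_lt_trans (ler0n _ _) lt.
  by rewrite ltr_pdivrMr // mul1r.
pose t := (1 + m) / 2.
have t0 : 0 < t by rewrite /t; lra.
have t1 : t < 1 by rewrite /t; lra.
have mt : m < t by rewrite /t; lra.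
have up u v (k : 'I_b.+1) : (k : nat)%:R < d (u, v) -> (k : nat)%:R < t * d (u, v).
  move=> lt; have d0 : 0 < d (u, v) := le_lt_trans (ler0n _ _) lt.
  rewrite -ltr_pdivrMr //; apply: le_lt_trans mt.
  exact: (@le_bigmax_cond _ _ _ 0 (u, v, k) (fun w => ((w.2 : nat)%:R : R) < d w.1) F lt).
have dn u v (k : 'I_b.+1) : u != v -> d (u, v) <= (k : nat)%:R -> t * d (u, v) < (k : nat)%:R.
  move=> uv le; have [d0|d0] := ltP 0 (d (u, v)); first by nra.
  have : d (u, v) != 0.
    rewrite subr_eq0 eq_sym -[x ord0 u]addr0; exact: Mx u v ord0 uv (cmp0 _ _).
  move=> ne; have k0 : (0 : R) <= (k : nat)%:R := ler0n _ _.
  by have : d (u, v) < 0 by [rewrite lt_neqAle ne]; nra.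
have tE u v (k : 'I_b.+1) : u != v -> ((k : nat)%:R < t * d (u, v)) = ((k : nat)%:R < d (u, v)).
  move=> uv; case: (ltP _ (d (u, v))) => [/up//|/(dn _ _ _ uv)/ltW]; by rewrite leNgt => /negbTE.
have tne u v (k : 'I_b.+1) : u != v -> t * d (u, v) != (k : nat)%:R.
  move=> uv; case: (ltP (k : nat)%:R (d (u, v))) => [/up/gt_eqF->//|/(dn _ _ _ uv)/lt_eqF->//].
pose y u := t * x ord0 u.
have yE u v : y v - y u = t * d (u, v) by rewrite mulrBr.
exists y; last first.
  move=> u v g uv cmp; rewrite /real_pos /= !addr0 -!ltrBrDl yE; exact: tE.
split.
- have neq u v (g k : 'I_b.+1) : u != v -> (k <= g)%N -> y u + (g : nat)%:R != y v + (k : nat)%:R.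
    move=> uv kg; apply/eqP => E.
    have lt : (g - k < b.+1)%N by rewrite (leq_ltn_trans (leq_subr _ _)).
    have /eqP[] := tne u v (Ordinal lt) uv; rewrite -yE /= natrB //; lra.
  move=> [u g] [v k]; rewrite /real_pos /=; case: (eqVneq u v) => [->|uv].
    by move=> /addrI/(mulrIn (oner_neq0 _)) E; congr (_, _); exact: val_inj.
  have vu : v != u by rewrite eq_sym.
  move=> E; case: (leqP k g) => [/(neq u v g k uv)/eqP//|/ltnW/(neq v u k g vu)/eqP[]].
  exact: esym.
- by move=> u g k gk; rewrite ltrD2l ltr_nat.
- move=> u v g k g' k' /(congr1 (fun i => i%:R : R)); rewrite !natrD /real_pos /= => E.
  by apply/idP/idP; lra.
Qed.

Lemma card_regions (R2 : rel 'I_n) (A : set (set 'rV[R]_n)) :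
  (0 < b)%N \/ (forall u v, D u v) ->
  ~` (\bigcup_(H in A) H) = generic ->
  (regions A #= `I_#|@mixed n b D R2 predT|)%card.
Proof.
move=> bD AE; rewrite /regions AE.
have cmp0 u v : compared D u v (ord0 : 'I_b.+1).
  by rewrite /compared; case: bD => [-> //|->]; rewrite orbT.
set P := @mixed n b D R2 predT.
have real p : P p -> exists x : 'rV[R]_n,
    valid (pos x) /\ forall v, is_pred (pos x) v (p v).
  move=> /asboolP[acy inj _].
  have [x [V xp]] := exists_real_pos R (in2T inj) acy.
  exists (\row_i x i).
  by have -> : (\row_i x i) ord0 = x by apply: funext => i; rewrite mxE.
have okP p : P p -> last_slot_ok D p.
  by move=> /asboolP[_ _ cond] v u /cond.
have [X XP] : exists X : {ffun 'I_n -> option ('I_n * 'I_b.+1)} -> 'rV[R]_n,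
    forall p, P p -> valid (pos (X p)) /\ forall v, is_pred (pos (X p)) v (p v).
  have H p : exists x : 'rV[R]_n, P p -> valid (pos x) /\ forall v, is_pred (pos x) v (p v).
    case: (boolP (P p)) => [/real[x xP]|_]; [by exists x|by exists 0].
  by exists (fun p => projT1 (cid (H p))) => p; case: cid.
have gen x : valid (pos x) -> generic x.
  move=> [inj _ _] u v g uv _; apply/eqP => E.
  have [e _] : (u, g) = (v, ord0) by apply: inj; rewrite /real_pos /= addr0.
  by rewrite e eqxx in uv.
pose p0 : {ffun 'I_n -> option ('I_n * 'I_b.+1)} := [ffun=> None].
(* The regions are numbered by the trees: number [k] contains a point realizing the [k]-th tree. *)
pose F k := connected_component generic (X (nth p0 (enum P) k)).
have FP k : (k < #|P|)%N -> P (nth p0 (enum P) k).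
  by move=> kP; rewrite -[P _]/(_ \in P) -mem_enum mem_nth // -cardE.
have -> : [set C | exists2 x, generic x & C = connected_component generic x] =
    F @` `I_#|P|.
  apply/seteqP; split=> C /=; last first.
    move=> [k kP <-]; exists (X (nth p0 (enum P) k)) => //.
    exact/gen/(proj1 (XP _ (FP k kP))).
  (* Every region occurs: perturb a point of it, exchange until [last_slot_ok] holds, and read off
     the tree; its realizing point has the same letter order and so lies in the region. *)
  move=> [x Mx ->].
  have [y V ag] := generic_perturb cmp0 Mx.
  have [pos' [p [V' ag' predp ok]]] := exists_agree_last_slot_ok V bD.
  have Pp : P (finfun p).
    apply/asboolP; split.
    - exists (rank pos') => v u s; rewrite ffunE => E.
      by have := predp v; rewrite E; exact: parent_rank.
    - move=> u v _ _; rewrite !ffunE; exact: (pred_inj V' predp).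
    - by move=> v u /=; rewrite ffunE; exact: ok.
  exists (index (finfun p) (enum P)).
    by rewrite /= cardE index_mem mem_enum.
  rewrite /F nth_index ?mem_enum //; have [VX predX] := XP _ Pp.
  apply: agree_component => //; first exact: gen.
  move=> u v g uv cmp; rewrite -ag // -ag' //.
  apply: (@eq_pred_eq_order _ _ _ _ _ p) => // w.
  by have := predX w; rewrite ffunE.
apply: inj_card_eq => k l; rewrite !inE /= => kP lP E.
(* Distinct trees give distinct regions: a common region forces the same letter order, hence the
   same predecessors. *)
have [Vk predk] := XP _ (FP k kP); have [Vl predl] := XP _ (FP l lP).
have ag : agree D (pos (X (nth p0 (enum P) k))) (pos (X (nth p0 (enum P) l))).
  apply: component_agree; rewrite -/(F k) E; exact/connected_component_refl/gen.
have same := agree_eq_order Vk Vl predk predl (okP _ (FP k kP)) (okP _ (FP l lP)) ag.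
have e : nth p0 (enum P) k = nth p0 (enum P) l.
  apply/ffunP => v; apply: is_pred_unique Vl _ (predl v).
  exact: eq_order_is_pred same (predk v).
by apply/eqP; rewrite -(nth_uniq p0 _ _ (enum_uniq P)) -?cardE //; apply/eqP.
Qed.

End Regions.

(** * The arrangement and the two cases of the theorem *)

Local Open Scope classical_set_scope.
Local Open Scope ring_scope.

(** An offset [g = k] on [i < j] compares the letter [(i, k)] with [(j, 0)], and [g = -k] compares
    [(j, k)] with [(i, 0)]. *)
Lemma complement_arrangement (R : realType) (n b : nat) (D : rel 'I_n) (lo hi : int) :
  (forall (i j : 'I_n) (g : int), (i < j)%N -> (lo <= g <= hi) <->
     exists k : 'I_b.+1, (g = (k : nat)%:Z /\ compared D i j k) \/
                         (g = - (k : nat)%:Z /\ compared D j i k)) ->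
  ~` (\bigcup_(H in arrangement R n lo hi) H) = @generic R n b D.
Proof.
move=> offsets; apply/seteqP; split=> x /=.
  move=> notin u v g uv cmp; apply/eqP => E; apply: notin.
  case: (ltngtP u v) => [lt|lt|e]; last by rewrite (val_inj e) eqxx in uv.
  - exists (hyperplane R u v (g : nat)%:Z); last first.
      by rewrite /hyperplane /= -pmulrn -E addrC addKr.
    by exists u, v, (g : nat)%:Z; split=> //; apply/(offsets u v _ lt); exists g; left.
  - exists (hyperplane R v u (- (g : nat)%:Z)); last first.
      by rewrite /hyperplane /= mulrNz -pmulrn -E opprD addrA subrr add0r.
    by exists v, u, (- (g : nat)%:Z); split=> //; apply/(offsets v u _ lt); exists g; right.
move=> gen [_ [i [j [g [ij lohi ->]]]]]; rewrite /hyperplane /=.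
have ne : i != j by apply: contraTneq ij => ->; rewrite ltnn.
have /(offsets _ _ _ ij)[k [[-> cmp]|[-> cmp]]] := lohi.
  rewrite -pmulrn => E; have /eqP[] := gen i j k ne cmp.
  by rewrite -E addrC subrK.
rewrite eq_sym in ne; rewrite mulrNz -pmulrn => E.
by have /eqP[] := gen j i k ne cmp; lra.
Qed.

Theorem corollary9 (R : realType) (n : nat) (a b : int)
    (hn : (1 <= n)%N) (hab : a <= b) (hsum : a + b = 0 \/ a + b = 1) :
  (regions (arrangement R n a b) #= `I_(num_forests `|1 - a|%N `|b|%N n))%card.
Proof.
rewrite num_forests_admissible.
case: b hab hsum => [b|b] hab hsum; last by exfalso; case: hsum; lia.
case: hsum => ab.
- have -> : `|1 - a|%N = b.+1 by lia.
  (* Both offsets [b] and [-b] occur, so all pairs are compared; the extra weight [b + 1] is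
     available to edges with [u < v]. *)
  pose D : rel 'I_n := fun _ _ => true; pose R2 : rel 'I_n := fun u v => (u < v)%N.
  rewrite (@card_admissible_mixed _ b _ _ D R2); last first.
    by move=> u v uv; rewrite /R2 absz_nat; case: ifP; rewrite ?addn1 ?addn0.
  rewrite (@card_mixed_chain _ _ _ _ id) //; last first.
    by move=> u v uv; rewrite andbT.
  apply: (@card_regions _ _ _ D _ _); first by right.
  apply: complement_arrangement => i j g ij; split.
    move=> lohi; have gb : (`|g| < b.+1)%N by lia.
    exists (Ordinal gb); rewrite /compared /D !orbT /=.
    by case: (lerP 0 g) => g0; [left|right]; split=> //; lia.
  by move=> [k [[-> _]|[-> _]]]; have := ltn_ord k; lia.
- have -> : `|1 - a|%N = b by lia.
  (* The offset [b] occurs but [-b] does not, so shift [b] is compared for [u < v] only; both kinds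
     of edges have the weights 1 to [b]. *)
  pose D : rel 'I_n := fun u v => (u < v)%N; pose R2 : rel 'I_n := fun _ _ => false.
  rewrite (@card_admissible_mixed _ b _ _ D R2); last first.
    by move=> u v uv; rewrite addn0 absz_nat if_same.
  have revE (u v : 'I_n) : (rev_ord u < rev_ord v)%N = (v < u)%N.
    by have := ltn_ord u; have := ltn_ord v => /=; lia.
  (* Larger labels enter first: then [D v x] holds for every earlier [x], while no earlier [u]
     satisfies [D u v], in accordance with the empty [R2]. *)
  rewrite (@card_mixed_chain _ _ _ _ (@rev_ord n)) //; first last.
  - by move=> v x; rewrite revE.
  - by move=> u v uv; rewrite revE /R2 /D; case: ltngtP.
  - exact: rev_ordK.
  apply: (@card_regions _ _ _ D _ _); first by left; lia.
  apply: complement_arrangement => i j g ij; split.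
    move=> lohi; have gb : (`|g| < b.+1)%N by lia.
    exists (Ordinal gb); rewrite /compared /D ij orbT /=.
    by case: (lerP 0 g) => g0; [left|right]; split=> //; lia.
  move=> [k [[-> _]|[-> ]]]; have := ltn_ord k; rewrite /compared /D; first by lia.
  by rewrite [(j < i)%N]ltnNge (ltnW ij) orbF; lia.
Qed.
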